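(* Let $(\mathrm D)$ be a projectively singular system of degree $n$ and let $a\in\mathbb{R}$. The following statements are equivalent: (1) $(\mathrm D)$ has an equilibrium state at infinity lying on the ''extremities'' of the straight line $y=ax$; (2) the point $(\xi,\theta)=(a,0)$ is an equilibrium state of the first projectively reduced system $$\frac{d\xi}{d\tau}=\sum_{j=0}^{n-1}\theta^{n-j-1}W_j(1,\xi),\qquad \frac{d\theta}{d\tau}=-\sum_{i=0}^n\theta^{n-i}X_i(1,\xi);$$ (3) $\xi=a$ is a solution of the system of equations $X_n(1,\xi)=0$, $W_{n-1}(1,\xi)=0$.
   Context: System $(\mathrm D)$ of degree $n$: $\frac{dx}{dt}=X(x,y)=\sum_{k=0}^n X_k(x,y)$, $\frac{dy}{dt}=Y(x,y)=\sum_{k=0}^n Y_k(x,y)$, where $X_k,Y_k$ are real homogeneous polynomials of degree $k$, $X_n$ and $Y_n$ are not both identically zero, and $X,Y$ are relatively prime (no common divisors other than real numbers). Put $W_i(x,y)=xY_i(x,y)-yX_i(x,y)$, $i=0,\dots,n$. The system is projectively singular if $W_n\equiv 0$ on $\mathbb{R}^2$ (this forces $n\ge1$). The projective phase plane $\mathbb{RP}(x,y)$ is the plane $(x,y)$ completed by the line at infinity, with charts $(x,y)$, $(\xi,\theta)=(\frac yx,\frac1x)$, $(\eta,\zeta)=(\frac1y,\frac xy)$; the trajectories in the chart $(\xi,\theta)$ are those of the first projectively reduced system, obtained from $(\mathrm D)$ by $x=\frac1\theta$, $y=\frac\xi\theta$ and removal of the common power of $\theta$ by a change of time. The point at infinity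 on the ''extremities'' of the line $y=ax$ is the point at infinity of this line, i.e. the point $(\xi,\theta)=(a,0)$. A point at infinity is an equilibrium state of $(\mathrm D)$ if it is an equilibrium of the field of trajectories so extended. *)

(* Defs.v *)
From mathcomp Require Import all_boot all_algebra.
From mathcomp Require Import classical_sets reals topology normedtype derive.
(* The notations of mpoly are incompatible with those of the analysis files. *)
From mathcomp Require Import -(notations) mpoly.
Import GRing.Theory Num.Theory.
Import numFieldNormedType.Exports.

Set Implicit Arguments.
Unset Strict Implicit.
Unset Printing Implicit Defensive.

Local Open Scope ring_scope.

Notation "{ 'mpoly' T [ n ] }" := (mpoly n T).

Section Polynomials.
Context {R : realType}.

Definition var1 : {mpoly R[2]} := mpolyX R (mnm1 (ord0 : 'I_2)).
Definition var2 : {mpoly R[2]} := mpolyX R (mnm1 (ord_max : 'I_2)).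

Definition peval (p : {mpoly R[2]}) (q : R * R) : R :=
  meval (tnth [tuple q.1; q.2]) p.

Definition homogeneous (k : nat) (p : {mpoly R[2]}) : Prop :=
  p \is ishomog1 k mdeg.

Definition pdivides (d p : {mpoly R[2]}) : Prop := exists u, p = d * u.

Definition relatively_prime (p q : {mpoly R[2]}) : Prop :=
  forall d, pdivides d p -> pdivides d q -> exists c : R, d = mpolyC 2 c.

End Polynomials.

Section PlanarSystem.
Context {R : realType}.
Implicit Types (n : nat) (X Y : nat -> {mpoly R[2]}).

(* Only the components of index at most n matter in X and Y. *)
Definition rhs n X : {mpoly R[2]} := \sum_(k < n.+1) X k.

Definition system_of_degree n X Y : Prop :=
  [/\ forall k, (k <= n)%N -> homogeneous k (X k) /\ homogeneous k (Y k),
      ~ (X n = 0 /\ Y n = 0)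
    & relatively_prime (rhs n X) (rhs n Y)].

Definition W X Y (i : nat) : {mpoly R[2]} := var1 * Y i - var2 * X i.

Definition projectively_singular n X Y : Prop :=
  forall x y : R, peval (W X Y n) (x, y) = 0.

Definition vfield (F : {mpoly R[2]} * {mpoly R[2]}) (q : R * R) : R * R :=
  (peval F.1 q, peval F.2 q).

Definition equilibrium_state (V : R * R -> R * R) (q : R * R) : Prop :=
  V q = (0, 0).

End PlanarSystem.

Section ProjectivePhasePlane.
Context {R : realType}.
Implicit Types (n : nat) (X Y : nat -> {mpoly R[2]}).

(* Points of RP(x,y) are given by homogeneous coordinates [hx : hy : hz], the
   finite point (x, y) being [x : y : 1]; triples are not identified up to
   scaling, but everything below depends only on their class. *)
Record ppoint := PPoint {
  hx : R; hy : R; hz : R;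
  ppoint_neq0 : [|| hx != 0, hy != 0 | hz != 0] }.

Lemma finite_point_subproof (q : R * R) :
  [|| q.1 != 0, q.2 != 0 | (1 : R) != 0].
Proof. by rewrite oner_neq0 !orbT. Qed.

Definition finite_point (q : R * R) : ppoint :=
  PPoint (finite_point_subproof q).

Definition at_infinity (p : ppoint) : Prop := hz p = 0.

(* The projective line completing the line y = a x. *)
Definition on_line (a : R) (p : ppoint) : Prop := hy p = a * hx p.

Inductive chart := Chart_x_y | Chart_xi_theta | Chart_eta_zeta.

Definition in_chart (c : chart) (p : ppoint) : Prop :=
  match c with
  | Chart_x_y => hz p != 0
  | Chart_xi_theta => hx p != 0
  | Chart_eta_zeta => hy p != 0
  end.

(* On finite points: (x, y), (y/x, 1/x) and (1/y, x/y). *)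
Definition chart_coord (c : chart) (p : ppoint) : R * R :=
  match c with
  | Chart_x_y => (hx p / hz p, hy p / hz p)
  | Chart_xi_theta => (hy p / hx p, hz p / hx p)
  | Chart_eta_zeta => (hz p / hy p, hx p / hy p)
  end.

(* F is the field obtained from the field V of the affine plane by the change
   of variables to the chart c, followed by a change of time removing the
   common power of s, where s = 0 is the equation of the line at infinity in
   that chart.  The derivatives along V of the two chart coordinates give the
   velocity, in the chart, of the trajectories of V.  The exponent m may be
   negative, and the last clause says that no power of s is left in F. *)
Definition reduced_at_infinity (c : chart) (s : {mpoly R[2]})
    (V F : {mpoly R[2]} * {mpoly R[2]}) : Prop :=
  (exists m : int, forall q : R * R, in_chart c (finite_point q) ->
     let phi := fun r : R * R => chart_coord c (finite_point r) in
     'D_(vfield V q) (fun r => (phi r).1) q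
       = (peval s (phi q)) ^ m * (vfield F (phi q)).1 /\
     'D_(vfield V q) (fun r => (phi r).2) q
       = (peval s (phi q)) ^ m * (vfield F (phi q)).2)
  /\ ~ (pdivides s F.1 /\ pdivides s F.2).

Definition reduced_system (c : chart) (V F : {mpoly R[2]} * {mpoly R[2]}) :
    Prop :=
  match c with
  | Chart_x_y => F = V
  | Chart_xi_theta => reduced_at_infinity c var2 V F
  | Chart_eta_zeta => reduced_at_infinity c var1 V F
  end.

(* Equilibrium of the field of trajectories extended to RP(x,y): being one
   does not depend on the chart, so it is required in every chart around p. *)
Definition projective_equilibrium n X Y (p : ppoint) : Prop :=
  forall c, in_chart c p ->
    exists2 F, reduced_system c (rhs n X, rhs n Y) F
             & equilibrium_state (vfield F) (chart_coord c p).

Definition first_reduced_system n X Y (q : R * R) : R * R :=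
  let: (xi, theta) := q in
  (\sum_(j < n) theta ^+ (n - j - 1) * peval (W X Y j) (1, xi),
   - \sum_(i < n.+1) theta ^+ (n - i) * peval (X i) (1, xi)).

End ProjectivePhasePlane.

(* Main.v *)
Require Import Defs.
From mathcomp Require Import all_boot all_order all_algebra.
From mathcomp Require Import reals.
From mathcomp Require Import topology normedtype derive.
From mathcomp Require Import -(notations) mpoly.
From mathcomp Require Import ring zify.
Import Order.TTheory GRing.Theory Num.Theory numFieldNormedType.Exports.
Local Open Scope ring_scope.

Set Implicit Arguments.
Unset Strict Implicit.
Unset Printing Implicit Defensive.

(** In the chart (xi, theta) = (y/x, 1/x) the field of (D) has the velocity
    ((x Y - y X) / x^2, - X / x^2).  Homogeneity turns a sum of components of
    degrees d, ..., d + N at the point (1/theta, xi/theta) into theta^-(d + N)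
    times a polynomial in xi and theta ([peval_rhs]); since W_n = 0, the sum
    of the W_i stops at degree n, exactly like the sum of the X_i, so that both
    velocities are theta^(2 - n) times the components of the first reduced
    system, which are polynomials.  On theta = 0 these components are
    W_{n-1}(1, xi) and - X_n(1, xi) ([homogenization_line]), which gives the
    equivalence with the pair of equations.

    No further power of theta can be removed: X_n(1, xi) does not vanish
    identically, because X_n = 0 together with x Y_n = y X_n would give Y_n = 0.
    A field obtained by removing the whole common power of theta is unique
    ([reduced_at_infinity_inj]), so the extended field is the first reduced
    system in this chart ([xi_theta_reduced]), and the point at infinity of
    y = a x, whose coordinates there are (a, 0), is an equilibrium exactly when
    (a, 0) is an equilibrium of that system.

    For a != 0 this point also lies in the chart (eta, zeta) = (1/y, x/y), at
    (0, 1/a).  The same computation gives there a reduced field equal to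
    (- Y_n(zeta, 1), - W_{n-1}(zeta, 1)) on the line at infinity
    ([eta_zeta_reduced]); by homogeneity and x Y_n = y X_n, it vanishes at
    (0, 1/a) when X_n and W_{n-1} vanish at (1, a)
    ([equilibrium_eta_zeta]). *)

(** * Polynomials in two variables and their values *)

Section Evaluation.
Context {R : realType}.
Implicit Types (p s u v : {mpoly R[2]}) (q r : R * R).

Lemma pevalE p q :
  peval p q = \sum_(m <- msupp p) mcoeff m p * (q.1 ^+ m ord0 * q.2 ^+ m ord_max).
Proof.
rewrite /peval mevalE; apply: eq_bigr => m _.
by rewrite big_ord_recl big_ord1 !(tnth_nth 0) /=; congr (_ * (_ * _ ^+ m _)); apply: val_inj.
Qed.

Lemma peval_var1 q : peval var1 q = q.1.
Proof. by rewrite /peval mevalXU. Qed.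

Lemma peval_var2 q : peval var2 q = q.2.
Proof. by rewrite /peval mevalXU. Qed.

Lemma peval0 q : peval 0 q = 0.
Proof. exact: raddf0. Qed.

Lemma peval1 q : peval 1 q = 1.
Proof. exact: rmorph1. Qed.

Lemma pevalN p q : peval (- p) q = - peval p q.
Proof. exact: raddfN. Qed.

Lemma pevalB p1 p2 q : peval (p1 - p2) q = peval p1 q - peval p2 q.
Proof. exact: raddfB. Qed.

Lemma pevalM p1 p2 q : peval (p1 * p2) q = peval p1 q * peval p2 q.
Proof. exact: rmorphM. Qed.

Lemma pevalX p k q : peval (p ^+ k) q = peval p q ^+ k.
Proof. exact: rmorphXn. Qed.

Lemma peval_sum k (P : 'I_k -> {mpoly R[2]}) q :
  peval (\sum_(i < k) P i) q = \sum_(i < k) peval (P i) q.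
Proof. exact: raddf_sum. Qed.

Lemma peval_homogeneous k p c x y : homogeneous k p ->
  peval p (c * x, c * y) = c ^+ k * peval p (x, y).
Proof.
move=> /dhomogP hp; rewrite !pevalE mulr_sumr !big_seq.
apply: eq_bigr => m /hp /= <-.
rewrite (_ : mdeg m = m ord0 + m ord_max)%N; last first.
  by rewrite mdegE big_ord_recl big_ord1; congr (_ + m _)%N; apply: val_inj.
by rewrite !exprMn exprD; ring.
Qed.

Lemma poly_eval_eq0 (P : {poly R}) : (forall x, P.[x] = 0) -> P = 0.
Proof.
move=> P0; apply/eqP; apply: contraT => Pn0.
have := @max_poly_roots _ P [seq i%:R | i <- iota 0 (size P)] Pn0.
rewrite size_map size_iota ltnn; apply.
  by apply/allP => x _; rewrite rootE P0.
by rewrite map_inj_uniq ?iota_uniq// => i j /eqP; rewrite eqr_nat => /eqP.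
Qed.

(** Kronecker's substitution y = x^N, with N larger than the degree of p, sends
    distinct monomials of p to distinct powers of x, so it reduces the claim to
    one variable. *)
Lemma peval_eq0 p : (forall q, peval p q = 0) -> p = 0.
Proof.
move=> p0; pose N := msize p.
pose e (m : multinom 2) := (m ord0 + N * m ord_max)%N.
have dlt m : m \in msupp p -> (m ord0 < N)%N.
  move=> /msize_mdeg_lt; apply: leq_trans.
  by rewrite mdegE big_ord_recl ltnS leq_addr.
have e_inj : {in msupp p &, injective e}.
  move=> m1 m2 /dlt h1 /dlt h2 e12.
  have N0 : (0 < N)%N by apply: leq_trans h1.
  have := congr1 (modn^~ N) e12; have := congr1 (divn^~ N) e12.
  rewrite /e ![(_ + N * _)%N]addnC ![(N * _)%N]mulnC !divnMDl // !modnMDl.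
  rewrite !modn_small // !divn_small // !addn0 => h1' h0'.
  apply/mnmP => i; case: i => -[|[|//]] hi.
    by rewrite (_ : Ordinal hi = ord0) //; exact: val_inj.
  by rewrite (_ : Ordinal hi = ord_max) //; exact: val_inj.
pose P : {poly R} := \sum_(m <- msupp p) mcoeff m p *: 'X^(e m).
have P0 : P = 0.
  apply: poly_eval_eq0 => x; rewrite -(p0 (x, x ^+ N)) pevalE horner_sum.
  by apply: eq_bigr => m _; rewrite hornerZ hornerXn /e exprD exprM.
apply/mpolyP => m; rewrite mcoeff0.
have [mp|/memN_msupp_eq0//] := boolP (m \in msupp p).
have := congr1 (fun P : {poly R} => P`_(e m)) P0.
rewrite coef_sum coef0 (bigD1_seq m) //= coefZ coefXn eqxx mulr1.
rewrite big1_seq ?addr0// => m' /andP[mm' m'p].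
rewrite coefZ coefXn; case: eqP => [/esym /e_inj|]; rewrite ?mulr0//.
by move=> /(_ m'p mp) /eqP; rewrite (negPf mm').
Qed.

(** Multiplying by s extends the equality to the curve s = 0. *)
Lemma peval_eq_off s p1 p2 : s != 0 ->
  (forall r, peval s r != 0 -> peval p1 r = peval p2 r) -> p1 = p2.
Proof.
move=> s0 h; apply/eqP; rewrite -subr_eq0.
have /eqP : s * (p1 - p2) = 0.
  apply: peval_eq0 => r; rewrite pevalM pevalB.
  by have [->|/h->] := eqVneq (peval s r) 0; rewrite ?mul0r// subrr mulr0.
by rewrite mulf_eq0 (negPf s0).
Qed.

Lemma var1_neq0 : var1 != 0 :> {mpoly R[2]}.
Proof.
apply/eqP => h; have := peval_var1 (1, 0); rewrite h peval0 => /esym/eqP.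
by rewrite oner_eq0.
Qed.

Lemma var2_neq0 : var2 != 0 :> {mpoly R[2]}.
Proof.
apply/eqP => h; have := peval_var2 (0, 1); rewrite h peval0 => /esym/eqP.
by rewrite oner_eq0.
Qed.

Definition psubst u v p : {mpoly R[2]} := comp_mpoly [tuple u; v] p.

Lemma peval_subst u v p r : peval (psubst u v p) r = peval p (peval u r, peval v r).
Proof.
rewrite /peval /psubst comp_mpoly_meval; apply: meval_eq => i.
by case: i => -[|[|//]] ?; rewrite !(tnth_nth 0).
Qed.

(** The polynomial left after clearing the denominator s in the sum of the
    P_i(u/s, v/s), i <= N, up to a power of s when P_i is homogeneous of
    degree d + i. *)
Definition homogenization N s u v (P : nat -> {mpoly R[2]}) : {mpoly R[2]} :=
  \sum_(i < N.+1) s ^+ (N - i) * psubst u v (P i).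

Lemma peval_rhs d N s u v P r :
    (forall i, (i <= N)%N -> homogeneous (d + i) (P i)) -> peval s r != 0 ->
  peval (rhs N P) (peval u r / peval s r, peval v r / peval s r) =
  (peval s r) ^- (d + N) * peval (homogenization N s u v P) r.
Proof.
move=> hP s0; rewrite !peval_sum mulr_sumr; apply: eq_bigr => -[i /= iN] _.
rewrite ![_ / peval s r]mulrC (peval_homogeneous _ _ _ (hP _ _))//.
rewrite pevalM pevalX peval_subst mulrA; congr (_ * _).
rewrite exprVn (_ : d + N = d + i + (N - i))%N; last by lia.
by rewrite [in RHS]exprD invfM -mulrA mulVf ?mulr1 ?expf_neq0.
Qed.

Lemma homogenization_line N s u v P r : peval s r = 0 ->
  peval (homogenization N s u v P) r = peval (P N) (peval u r, peval v r).
Proof.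
move=> s0; rewrite peval_sum big_ord_recr /= big1 ?add0r => [|i _].
  by rewrite pevalM pevalX subnn expr0 mul1r peval_subst.
by rewrite pevalM pevalX s0 expr0n subn_eq0 leqNgt ltn_ord mul0r.
Qed.

End Evaluation.

(** * Derivatives of the chart coordinates *)

Section Derivatives.
Context {R : realType}.
Implicit Types (f g : R * R -> R) (q v : R * R).

Lemma is_derive_linear (V W : normedModType R) (L : {linear V -> W}) (q v : V) :
  continuous L -> is_derive q v L (L v).
Proof.
move=> Lc; have Ld : differentiable L q by exact: linear_differentiable.
by apply: DeriveDef; [exact: diff_derivable | rewrite deriveE// diff_lin].
Qed.

Lemma is_derive_fst q v : is_derive q v (fun r : R * R => r.1) v.1.
Proof. by apply: (@is_derive_linear _ _ fst) => r; exact: cvg_fst. Qed.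

Lemma is_derive_snd q v : is_derive q v (fun r : R * R => r.2) v.2.
Proof. by apply: (@is_derive_linear _ _ snd) => r; exact: cvg_snd. Qed.

Lemma is_derive_div f g q v df dg : g q != 0 ->
  is_derive q v f df -> is_derive q v g dg ->
  'D_v (fun r => f r / g r) q = (df * g q - f q * dg) / g q ^+ 2.
Proof.
move=> g0 hf hg.
rewrite (deriveM (g := fun r => (g r)^-1)) //; last exact: derivableV.
rewrite deriveV // !derive_val /GRing.scale /=.
by field.
Qed.

End Derivatives.

(** * Uniqueness of the reduced field *)

Section Charts.
Context {R : realType}.
Implicit Types (n : nat) (X Y : nat -> {mpoly R[2]}).
Implicit Types (p : {mpoly R[2]}) (q r : R * R).

(** Two such fields satisfy s^m F = s^k G off the line s = 0, because every point
    off this line comes from a finite point.  If m < k this becomes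
    F = s^(k - m) G as polynomials, which contradicts that s does not divide
    both components of F. *)
Lemma reduced_at_infinity_inj (c : chart) (s : {mpoly R[2]}) V F G :
    s != 0 ->
    (forall r, peval s r != 0 -> exists2 q, in_chart c (finite_point q)
       & chart_coord c (finite_point q) = r) ->
  reduced_at_infinity c s V F -> reduced_at_infinity c s V G -> F = G.
Proof.
move=> s0 onto [[m hm] Fs] [[k hk] Gs].
wlog mk : m k F G hm Fs hk Gs / (m <= k)%R.
  move=> H; have [/H|/ltW/H] := leP m k; first exact.
  by move=> H1; apply/esym/H1.
have eqFG r : peval s r != 0 ->
    vfield F r = (peval s r ^+ `|k - m|%N * (vfield G r).1,
                  peval s r ^+ `|k - m|%N * (vfield G r).2).
  move=> sr; have [q /[dup] /hm [f1 f2] /hk [g1 g2] qr] := onto r sr.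
  move: f1 f2 g1 g2; rewrite qr => -> -> h1 h2.
  have sm : peval s r ^ m != 0 by rewrite expfz_neq0.
  have e : peval s r ^ k = peval s r ^ m * peval s r ^+ `|k - m|%N.
    by rewrite [k in LHS](_ : k = m + `|k - m|%N) ?expfzDr //; lia.
  rewrite [LHS]surjective_pairing; congr pair.
    by apply: (mulfI sm); rewrite h1 e mulrA.
  by apply: (mulfI sm); rewrite h2 e mulrA.
have F1 : F.1 = s ^+ `|k - m|%N * G.1.
  by apply: (peval_eq_off s0) => r /eqFG [-> _]; rewrite pevalM pevalX.
have F2 : F.2 = s ^+ `|k - m|%N * G.2.
  by apply: (peval_eq_off s0) => r /eqFG [_ ->]; rewrite pevalM pevalX.
case: `|k - m|%N F1 F2 => [|e] F1 F2.
  by rewrite [F]surjective_pairing F1 F2 !expr0 !mul1r -surjective_pairing.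
by case: Fs; split; [exists (s ^+ e * G.1) | exists (s ^+ e * G.2)];
  rewrite mulrA -exprS.
Qed.


(** * Projectively singular systems in the charts at infinity *)

(** The right-hand side of the first reduced system as a pair of polynomials in
    (xi, theta); the sum of the W_i stops at n - 1 because W_n = 0. *)
Definition xi_theta_field n X Y : {mpoly R[2]} * {mpoly R[2]} :=
  (homogenization n.-1 var2 1 var1 (W X Y), - homogenization n var2 1 var1 X).

(** Its analogue in (eta, zeta), where the velocity is
    (- Y / y^2, - (x Y - y X) / y^2). *)
Definition eta_zeta_field n X Y : {mpoly R[2]} * {mpoly R[2]} :=
  (- homogenization n var1 var2 1 Y, - homogenization n.-1 var1 var2 1 (W X Y)).

Lemma onto_xi_theta r : r.2 != 0 ->
  exists2 q : R * R, in_chart Chart_xi_theta (finite_point q)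
    & chart_coord Chart_xi_theta (finite_point q) = r.
Proof.
case: r => xi th /= th0; exists (1 / th, xi / th) => /=.
  by rewrite div1r invr_eq0.
by congr pair; field.
Qed.

Lemma homogeneous_W k X Y :
  homogeneous k (X k) -> homogeneous k (Y k) -> homogeneous k.+1 (W X Y k).
Proof.
have hv : forall i, homogeneous 1 (mpolyX R (mnm1 i) : {mpoly R[2]}).
  by move=> i; rewrite /homogeneous dhomogX; apply/eqP; exact: mdeg1.
by move=> hX hY; apply: rpredB; rewrite -[k.+1]add1n; apply: dhomogM => //; apply: hv.
Qed.

Lemma rhs_W n X Y : (0 < n)%N -> W X Y n = 0 ->
  rhs n.-1 (W X Y) = var1 * rhs n Y - var2 * rhs n X.
Proof.
move=> n0 Wn; rewrite /rhs (prednK n0) !mulr_sumr -sumrB.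
by rewrite [RHS]big_ord_recr /= -/(W X Y n) Wn addr0.
Qed.

Lemma peval_homogeneous_x k p x y : homogeneous k p -> x != 0 ->
  peval p (x, y) = x ^+ k * peval p (1, y / x).
Proof.
by move=> hp x0; rewrite -peval_homogeneous // mulr1 mulrCA divff // mulr1.
Qed.

Lemma peval_homogeneous_y k p x y : homogeneous k p -> y != 0 ->
  peval p (x, y) = y ^+ k * peval p (x / y, 1).
Proof.
by move=> hp y0; rewrite -peval_homogeneous // mulr1 mulrCA divff // mulr1.
Qed.

(** By homogeneity p is determined off x = 0 by its values on the line x = 1. *)
Lemma homogeneous_eq0_x k p : homogeneous k p ->
  (forall xi, peval p (1, xi) = 0) -> p = 0.
Proof.
move=> hp p0; apply: (peval_eq_off var1_neq0) => -[x y].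
rewrite peval_var1 => /= x0.
by rewrite (peval_homogeneous_x _ hp) // p0 mulr0 peval0.
Qed.

Lemma homogeneous_eq0_y k p : homogeneous k p ->
  (forall zeta, peval p (zeta, 1) = 0) -> p = 0.
Proof.
move=> hp p0; apply: (peval_eq_off var2_neq0) => -[x y].
rewrite peval_var2 => /= y0.
by rewrite (peval_homogeneous_y _ hp) // p0 mulr0 peval0.
Qed.

Lemma exprz_2Bn (t : R) n : t != 0 -> t ^ (2 - n%:Z) = t ^+ 2 * t ^- n.
Proof. by move=> t0; rewrite expfzDr // -exprnN. Qed.

Section SingularSystem.
Context (n : nat) (X Y : nat -> {mpoly R[2]}).
Hypothesis n_gt0 : (0 < n)%N.
Hypothesis homX : forall k, (k <= n)%N -> homogeneous k (X k).
Hypothesis homY : forall k, (k <= n)%N -> homogeneous k (Y k).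
Hypothesis Wn0 : W X Y n = 0.
Hypothesis Xn_neq0 : X n <> 0.
Hypothesis Yn_neq0 : Y n <> 0.

Let homW k : (k <= n.-1)%N -> homogeneous (1 + k) (W X Y k).
Proof.
move=> kn; have {}kn : (k <= n)%N by rewrite (leq_trans kn) ?leq_pred.
by apply: homogeneous_W; [apply: homX | apply: homY].
Qed.

(** The exponent 2 - n is the one found by substituting x = 1/theta and
    y = xi/theta in the velocity; theta does not divide the second component
    because its value at (xi, 0) is - X_n(1, xi). *)
Lemma xi_theta_reduced :
  reduced_system Chart_xi_theta (rhs n X, rhs n Y) (xi_theta_field n X Y).
Proof.
split; last first.
  move=> [_ [G hG]]; apply: Xn_neq0; apply: (homogeneous_eq0_x (homX (leqnn n))).
  move=> xi; have := congr1 (peval^~ (xi, 0)) hG.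
  rewrite pevalN pevalM peval_var2 mul0r homogenization_line ?peval_var2 //.
  by rewrite peval1 peval_var1 => /eqP; rewrite oppr_eq0 => /eqP.
exists (2 - n%:Z) => q /= q1.
(* r is the image of q in the chart, and q is (1/theta, xi/theta). *)
set r := (q.2 / q.1, 1 / q.1).
have r2 : r.2 != 0 by rewrite /r /= div1r invr_eq0.
have qE : (peval 1 r / peval var2 r, peval var1 r / peval var2 r) = q.
  rewrite peval1 peval_var1 peval_var2 /r [RHS]surjective_pairing /=.
  by congr pair; field.
have s0 : peval var2 r != 0 by rewrite peval_var2.
have eX := @peval_rhs _ 0 n var2 1 var1 X r homX s0.
have eW := @peval_rhs _ 1 n.-1 var2 1 var1 (W X Y) r homW s0.
rewrite exprz_2Bn // {}qE rhs_W // pevalB !pevalM peval_var1 !peval_var2 in eX eW *.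
rewrite add0n add1n prednK // in eX eW.
split.
  rewrite (is_derive_div q1 (is_derive_snd _ _) (is_derive_fst _ _)) /=.
  rewrite -[RHS]mulrA -eW /r /= div1r exprVn.
  by field.
rewrite (is_derive_div q1 (is_derive_cst _ _ _) (is_derive_fst _ _)) /=.
rewrite pevalN mulrN -[in RHS]mulrA -eX /r /= div1r exprVn.
by rewrite mul0r mul1r sub0r mulNr mulrC.
Qed.

(** Here eta does not divide the first component, whose value at (0, zeta) is
    - Y_n(zeta, 1). *)
Lemma eta_zeta_reduced :
  reduced_system Chart_eta_zeta (rhs n X, rhs n Y) (eta_zeta_field n X Y).
Proof.
split; last first.
  move=> [[G hG] _]; apply: Yn_neq0; apply: (homogeneous_eq0_y (homY (leqnn n))).
  move=> xi; have := congr1 (peval^~ (0, xi)) hG.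
  rewrite pevalN pevalM peval_var1 mul0r homogenization_line ?peval_var1 //.
  by rewrite peval1 peval_var2 => /eqP; rewrite oppr_eq0 => /eqP.
exists (2 - n%:Z) => q /= q2.
(* r is the image of q in the chart, and q is (zeta/eta, 1/eta). *)
set r := (1 / q.2, q.1 / q.2).
have r1 : r.1 != 0 by rewrite /r /= div1r invr_eq0.
have qE : (peval var2 r / peval var1 r, peval 1 r / peval var1 r) = q.
  rewrite peval1 peval_var1 peval_var2 /r [RHS]surjective_pairing /=.
  by congr pair; field.
have s0 : peval var1 r != 0 by rewrite peval_var1.
have eY := @peval_rhs _ 0 n var1 var2 1 Y r homY s0.
have eW := @peval_rhs _ 1 n.-1 var1 var2 1 (W X Y) r homW s0.
rewrite exprz_2Bn // {}qE rhs_W // pevalB !pevalM peval_var2 !peval_var1 in eY eW *.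
rewrite add0n add1n prednK // in eY eW.
split.
  rewrite (is_derive_div q2 (is_derive_cst _ _ _) (is_derive_snd _ _)) /=.
  rewrite pevalN mulrN -[in RHS]mulrA -eY /r /= div1r exprVn.
  by rewrite mul0r mul1r sub0r mulNr mulrC.
rewrite (is_derive_div q2 (is_derive_fst _ _) (is_derive_snd _ _)) /=.
rewrite pevalN mulrN -[in RHS]mulrA -eW /r /= div1r exprVn.
by field.
Qed.

Lemma vfield_xi_theta q :
  vfield (xi_theta_field n X Y) q = first_reduced_system n X Y q.
Proof.
case: q => xi th; rewrite /vfield /= /homogenization pevalN !peval_sum.
congr pair; last first.
  congr (- _); apply: eq_bigr => i _.
  by rewrite pevalM pevalX peval_subst peval1 peval_var1 peval_var2.
rewrite prednK //; apply: eq_bigr => i _.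
rewrite pevalM pevalX peval_subst peval1 peval_var1 peval_var2 /=.
by congr (_ ^+ _ * _); lia.
Qed.

Lemma equilibrium_first_reduced a :
  equilibrium_state (first_reduced_system n X Y) (a, 0) <->
  peval (X n) (1, a) = 0 /\ peval (W X Y n.-1) (1, a) = 0.
Proof.
rewrite /equilibrium_state -vfield_xi_theta /vfield /= pevalN.
rewrite !homogenization_line ?peval_var2 // peval1 peval_var1 /=.
split=> [[-> /eqP]|[-> ->]]; last by rewrite oppr0.
by rewrite oppr_eq0 => /eqP.
Qed.

(** At (1, a) the identity x Y_n = y X_n reads Y_n(1, a) = a X_n(1, a), and
    homogeneity moves a zero at (1, a) to the proportional point (1/a, 1). *)
Lemma equilibrium_eta_zeta a : a != 0 ->
  peval (X n) (1, a) = 0 -> peval (W X Y n.-1) (1, a) = 0 ->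
  equilibrium_state (vfield (eta_zeta_field n X Y)) (0, a^-1).
Proof.
move=> a0 Xa Wa.
have Ya : peval (Y n) (1, a) = 0.
  have := congr1 (peval^~ (1, a)) Wn0.
  by rewrite pevalB !pevalM peval_var1 Xa mulr0 subr0 mul1r peval0.
rewrite /equilibrium_state /vfield /= !pevalN.
rewrite !homogenization_line ?peval_var1 // peval1 peval_var2 /=.
have inv p k : homogeneous k p -> peval p (1, a) = 0 -> peval p (a^-1, 1) = 0.
  move=> hp pa; have := peval_homogeneous a^-1 1 a hp.
  by rewrite mulr1 mulVf // pa mulr0.
by rewrite (inv _ _ (homY (leqnn n)) Ya) (inv _ _ (homW (leqnn _)) Wa) oppr0.
Qed.

(** A point at infinity of y = a x has hx != 0, and its chart coordinates are
    those of the representative [1 : a : 0] used for the converse. *)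
Lemma equilibrium_at_infinity a :
  (exists p : @ppoint R,
      [/\ at_infinity p, on_line a p & projective_equilibrium n X Y p])
   <-> equilibrium_state (first_reduced_system n X Y) (a, 0).
Proof.
split=> [[[x y z xyz] [/= z0 yax eqp]]|].
  rewrite /at_infinity /on_line /= in z0 yax.
  have x0 : x != 0.
    by apply/eqP => x0; have := xyz; rewrite yax z0 x0 mulr0 !eqxx.
  have [F Fred] := eqp Chart_xi_theta x0.
  have -> : chart_coord Chart_xi_theta (PPoint xyz) = (a, 0).
    by rewrite /= yax z0 mul0r mulfK.
  rewrite /equilibrium_state -vfield_xi_theta.
  suff -> : F = xi_theta_field n X Y by [].
  apply: (reduced_at_infinity_inj var2_neq0 _ Fred xi_theta_reduced) => r.
  by rewrite peval_var2; exact: onto_xi_theta.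
move=> /[dup] eqG /equilibrium_first_reduced [Xa Wa].
have pn0 : [|| (1 : R) != 0, a != 0 | (0 : R) != 0] by rewrite oner_neq0.
exists (PPoint pn0); split; rewrite /at_infinity /on_line /= ?mulr1 //.
case=> /=; first by rewrite eqxx.
- move=> _; exists (xi_theta_field n X Y); first exact: xi_theta_reduced.
  by rewrite /equilibrium_state vfield_xi_theta divr1 mul0r.
- move=> a0; exists (eta_zeta_field n X Y); first exact: eta_zeta_reduced.
  by rewrite mul0r div1r; exact: equilibrium_eta_zeta.
Qed.

End SingularSystem.

End Charts.

(** * Consequences of projective singularity *)

Section Nondegeneracy.
Context {R : realType}.
Context (n : nat) (X Y : nat -> {mpoly R[2]}).
Hypothesis sing : projectively_singular n X Y.

Lemma singular_W0 : W X Y n = 0.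
Proof. by apply: peval_eq0 => -[x y]; exact: sing. Qed.

Lemma singular_Xn0 : X n = 0 -> Y n = 0.
Proof.
move=> X0; have /eqP := singular_W0; rewrite /W X0 mulr0 subr0.
by rewrite mulf_eq0 (negPf var1_neq0) => /eqP.
Qed.

Lemma singular_Yn0 : Y n = 0 -> X n = 0.
Proof.
move=> Y0; have /eqP := singular_W0; rewrite /W Y0 mulr0 sub0r oppr_eq0.
by rewrite mulf_eq0 (negPf var2_neq0) => /eqP.
Qed.

(** In degree 0, Y_0 is constant, and W_0(1, 0) = Y_0(1, 0) is zero. *)
Lemma singular_degree_gt0 : homogeneous n (Y n) -> Y n <> 0 -> (0 < n)%N.
Proof.
rewrite lt0n => hY Yn0; apply/eqP => n0; apply: Yn0.
have hc x y : peval (Y n) (x, y) = peval (Y n) (0, 0).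
  by have := peval_homogeneous 0 x y hY; rewrite !mul0r n0 expr0 mul1r.
apply: peval_eq0 => -[x y]; rewrite hc -(hc 1 0).
by have := sing 1 0; rewrite pevalB !pevalM peval_var1 peval_var2 mul0r subr0 mul1r.
Qed.

End Nondegeneracy.

(** * Equilibria at infinity of a projectively singular system *)

Theorem mainTheorem15 (R : realType) (n : nat) (X Y : nat -> {mpoly R[2]})
    (a : R) (hD : system_of_degree n X Y)
    (hsing : projectively_singular n X Y) :
  ((exists p : @ppoint R,
      [/\ at_infinity p, on_line a p & projective_equilibrium n X Y p])
   <-> equilibrium_state (first_reduced_system n X Y) (a, 0))
  /\
  (equilibrium_state (first_reduced_system n X Y) (a, 0)
   <-> (peval (X n) (1, a) = 0 /\ peval (W X Y n.-1) (1, a) = 0)).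
Proof.
case: hD => hom top0 _.
have homX k : (k <= n)%N -> homogeneous k (X k) by case/hom.
have homY k : (k <= n)%N -> homogeneous k (Y k) by case/hom.
have Xn0 : X n <> 0 by move=> X0; apply: top0; split=> //; exact: singular_Xn0.
have Yn0 : Y n <> 0 by move=> Y0; apply: top0; split=> //; exact: singular_Yn0.
have n0 := singular_degree_gt0 hsing (homY n (leqnn n)) Yn0.
split; first exact: (equilibrium_at_infinity n0 homX homY (singular_W0 hsing)).
exact: equilibrium_first_reduced.
Qed.
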